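(* Let $\mathbb{G}$ be a Green kernel of type $(s,\gamma)$ on $\Omega$ with Green operator $\mathcal{G}$, admitting a $\gamma$-normal derivative $D_\gamma\mathbb{G}$. Let $f\in L^1_c(\Omega)$ and $u=\mathcal{G}(f)$. Then $D_\gamma u(z)$ is well-defined for every $z\in\partial\Omega$, and $$D_\gamma u(z)=\int_\Omega D_\gamma\mathbb{G}(z,y)\,f(y)\,dy,\qquad z\in\partial\Omega.$$ Furthermore there is a constant $C$, independent of $f$ and $z$, such that $$|D_\gamma u(z)|\le C\,\|f\|_{L^1(\Omega)}\,\mathrm{dist}\big(z,\mathrm{supp}(f)\big)^{2s-2\gamma-n},\qquad z\in\partial\Omega.$$
   Context: $\Omega\subset\mathbb{R}^n$ ($n\ge1$) is a bounded domain with $C^{1,1}$ boundary and $\delta(x)=\mathrm{dist}(x,\partial\Omega)$. Write $a\wedge b=\min\{a,b\}$. For nonnegative functions, $f\asymp g$ on a set means that there is a constant $C>0$ with $C^{-1}g\le f\le Cg$ on that set. $L^1_c(\Omega)$ is the space of integrable functions with compact support in $\Omega$. A Green kernel of type $(s,\gamma)$ on $\Omega$, where $s,\gamma\in(0,1]$ and $2s\le n$, is a measurable function $\mathbb{G}:\Omega\times\Omega\to\mathbb{R}$ such that $\mathbb{G}(x,y)=\mathbb{G}(y,x)$ and $$\mathbb{G}(x,y)\asymp\frac{1}{|x-y|^{n-2s}}\Big(\frac{\delta(x)\delta(y)}{|x-y|^2}\wedge1\Big)^\gamma,\qquad x,y\in\Omega,\ x\ne y.$$ Its Green operator is $\mathcal{G}(f)(x)=\int_\Omega\mathbb{G}(x,y)f(y)\,dy$.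 $\mathbb{G}$ admits a $\gamma$-normal derivative if there exists a (measurable) function $D_\gamma\mathbb{G}:\partial\Omega\times\Omega\to\mathbb{R}$ such that for every $z\in\partial\Omega$ and every sequence $x_j\in\Omega$ with $x_j\to z$ one has $\lim_j\mathbb{G}(x_j,\cdot)/\delta(x_j)^\gamma=D_\gamma\mathbb{G}(z,\cdot)$ a.e. in $\Omega$. For a function $u$ on $\Omega$, its $\gamma$-normal derivative at $z\in\partial\Omega$ is $D_\gamma u(z)=\lim_{x\to z,\,x\in\Omega}u(x)/\delta(x)^\gamma$, when this limit exists. *)

(* Defs.v *)
From HB Require Import structures.
From mathcomp Require Import all_boot all_order all_algebra.
From mathcomp Require Import all_classical all_reals all_analysis.

Set Implicit Arguments.
Unset Strict Implicit.
Unset Printing Implicit Defensive.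

Import Order.TTheory GRing.Theory Num.Theory.
Import numFieldNormedType.Exports.

Local Open Scope classical_set_scope.
Local Open Scope ring_scope.

(* [lebesgue_rV n] is the Lebesgue measure on R^n: the n-fold product of
   [lebesgue_measure] on n-tuples, transported to row vectors. It is defined on
   the Borel sigma-algebra and characterized by [lebesgue_rV_box]. *)

HB.instance Definition _ (R : realType) (n : nat) :=
  @isMeasurable.Build default_measure_display 'rV[R]_n
    <<s @open 'rV[R]_n >> (@sigma_algebra0 _ _ _)
    (@sigma_algebraC _ _) (@sigma_algebra_bigcup _ _ _).

Section pushforward.
Local Open Scope ereal_scope.
Context d d' (T : measurableType d) (T' : measurableType d') (R : realType).

Lemma pushforward_semi_sigma_additive (m : {measure set T -> \bar R})
    (f : T -> T') :
  measurable_fun [set: T] f -> semi_sigma_additive (pushforward m f).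
Proof.
move=> mf F mF tF mUF; rewrite /pushforward preimage_bigcup.
apply: measure_semi_sigma_additive.
- by move=> n; rewrite -[X in measurable X]setTI; exact: mf.
- apply/trivIsetP => /= i j _ _ ij; rewrite -preimage_setI.
  by move/trivIsetP : tF => /(_ _ _ _ _ ij) ->//; rewrite preimage_set0.
- by rewrite -preimage_bigcup -[X in measurable X]setTI; exact: mf.
Qed.

Lemma pushforward_sigma_finite (m : set T -> \bar R)
    (f : T -> T') (g : T' -> T) : sigma_finite [set: T] m ->
  measurable_fun [set: T'] g -> cancel f g ->
  sigma_finite [set: T'] (pushforward m f).
Proof.
move=> [F TF Foo] mg fK.
exists (fun i => g @^-1` F i).
  by rewrite -preimage_bigcup -TF preimage_setT.
move=> i; have [mFi Fioo] := Foo i; split.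
  by rewrite -[X in measurable X]setTI; exact: mg.
rewrite /pushforward (_ : _ @^-1` _ = F i)//.
by apply/seteqP; split => x /=; rewrite fK.
Qed.

Lemma product_sigma_finite (m : {sigma_finite_measure set T -> \bar R})
    (m' : {sigma_finite_measure set T' -> \bar R}) :
  sigma_finite [set: T * T'] (m \x m').
Proof.
have /sigma_finiteP[F [TF ndF Foo]] := sigma_finiteT m.
have /sigma_finiteP[G [TG ndG Goo]] := sigma_finiteT m'.
exists (fun i => F i `*` G i).
  rewrite -setXTT TF TG predeqE => -[x y]; split.
    move=> [/= [i _ Fix] [j _ Gjy]]; exists (maxn i j) => //; split.
    - by move: x Fix; exact/subsetPset/ndF/leq_maxl.
    - by move: y Gjy; exact/subsetPset/ndG/leq_maxr.
  by move=> [i _ []/= ? ?]; split; exists i.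
move=> i; have [? ?] := Foo i; have [? ?] := Goo i.
split; first exact: measurableX.
by rewrite product_measure1E// lte_mul_pinfty// ge0_fin_numE.
Qed.

End pushforward.

Section tuple_lebesgue.
Context {R : realType}.

Let mR := measurableTypeR R.

Definition tuple_cons n (p : mR * n.-tuple mR) : n.+1.-tuple mR :=
  [tuple of p.1 :: p.2].

Lemma measurable_tuple_cons n : measurable_fun [set: _] (@tuple_cons n).
Proof. exact: measurable_cons. Qed.

Definition tuple_uncons n (t : n.+1.-tuple mR) : mR * n.-tuple mR :=
  (thead t, [tuple of behead t]).

Lemma measurable_tuple_uncons n : measurable_fun [set: _] (@tuple_uncons n).
Proof.
apply/measurable_fun_pair; first exact: measurable_tnth.
exact: measurable_behead.
Qed.

Lemma tuple_consK n : cancel (@tuple_cons n) (@tuple_uncons n).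
Proof.
by case=> x t; rewrite /tuple_uncons theadE; congr (_, _); apply: val_inj.
Qed.

Section step.
Variables (n : nat) (mu : {sigma_finite_measure set (n.-tuple mR) -> \bar R}).

Definition tuple_step : set (n.+1.-tuple mR) -> \bar R :=
  pushforward (@lebesgue_measure R \x mu)%E (@tuple_cons n).

Let step0 : tuple_step set0 = 0%E.
Proof. by rewrite /tuple_step /pushforward preimage_set0 measure0. Qed.

Let step_ge0 A : (0 <= tuple_step A)%E.
Proof. by apply: integral_ge0 => x _; exact: measure_ge0. Qed.

Let step_sigma_additive : semi_sigma_additive tuple_step.
Proof.
exact: (pushforward_semi_sigma_additive (m := (lebesgue_measure \x mu)%E)
  (@measurable_tuple_cons n)).
Qed.

HB.instance Definition _ := isMeasure.Build _ _ _ tuple_step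
  step0 step_ge0 step_sigma_additive.

Let step_sigma_finite : sigma_finite [set: _] tuple_step.
Proof.
exact: (pushforward_sigma_finite (product_sigma_finite _ _)
  (@measurable_tuple_uncons n) (@tuple_consK n)).
Qed.

HB.instance Definition _ := Measure_isSigmaFinite.Build _ _ _ tuple_step
  step_sigma_finite.

End step.

Fixpoint tuple_lebesgue n : {sigma_finite_measure set (n.-tuple mR) -> \bar R} :=
  match n with
  | 0 => \d_ ([tuple] : 0.-tuple mR)
  | m.+1 => tuple_step (tuple_lebesgue m)
  end.

Lemma measurable_tuple_box n (B : 'I_n -> set mR) :
  (forall i, measurable (B i)) ->
  measurable [set t : n.-tuple mR | forall i, B i (tnth t i)].
Proof.
move=> mB.
rewrite (_ : mkset _ = \bigcap_(i in [set: 'I_n]) ((@tnth n mR)^~ i @^-1` B i)).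
  apply: fin_bigcap_measurable => // i _.
  by rewrite -[X in measurable X]setTI; exact: measurable_tnth.
by apply/seteqP; split => [t tB i _|t tB i]; exact: tB.
Qed.

Lemma tuple_lebesgue_box n (B : 'I_n -> set mR) :
  (forall i, measurable (B i)) ->
  tuple_lebesgue n [set t | forall i, B i (tnth t i)] =
  (\prod_(i < n) lebesgue_measure (B i))%E.
Proof.
elim: n B => [|n IH] B mB /=.
  by rewrite big_ord0 diracE mem_set//= => -[].
rewrite big_ord_recl -(IH (fun i => B (lift ord0 i)))//.
set C := [set t : n.-tuple mR | _].
have mC : measurable C.
  exact: (measurable_tuple_box (fun i => mB (lift ord0 i))).
rewrite -(product_measure1E lebesgue_measure (tuple_lebesgue n) (mB ord0) mC).
rewrite /tuple_step /pushforward; congr (product_measure1 _ _ _).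
apply/seteqP; split => -[x t] /= H.
  split; first by have := H ord0; rewrite tnth0.
  by move=> i; have := H (lift ord0 i); rewrite tnthS.
move=> i; case: (unliftP ord0 i) => [j ->|->].
  by rewrite tnthS; apply: H.2.
by rewrite tnth0; exact: H.1.
Qed.

End tuple_lebesgue.

Section rV_lebesgue.
Context {R : realType} (n : nat).

Let mR := measurableTypeR R.

Definition rV_of_tuple (t : n.-tuple mR) : 'rV[R]_n := \row_i tnth t i.

Definition tuple_of_rV (x : 'rV[R]_n) : n.-tuple mR := [tuple x 0 i | i < n].

Lemma rV_of_tupleK : cancel rV_of_tuple tuple_of_rV.
Proof. by move=> t; apply: eq_from_tnth => i; rewrite tnth_mktuple mxE. Qed.

Lemma open_measurable_rV (A : set 'rV[R]_n) : open A -> measurable A.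
Proof. exact: sub_sigma_algebra. Qed.

Lemma measurable_coord_rV (i : 'I_n) :
  measurable_fun [set: 'rV[R]_n] (fun x : 'rV[R]_n => x 0 i : mR).
Proof.
apply: (@measurability _ _ _ _ _ _ _ (measurable_realfun.RGenOpens.measurableE R)).
move=> _ [_ [a [b ->]] <-]; rewrite setTI.
apply: open_measurable_rV; apply: open_comp; last exact: interval_open.
by move=> x _; exact: coord_continuous.
Qed.

Lemma measurable_tuple_of_rV : measurable_fun [set: _] tuple_of_rV.
Proof.
apply/measurable_fun_tnthP => i.
rewrite (_ : _ \o _ = fun x : 'rV[R]_n => x 0 i); last first.
  by apply/funext => x /=; rewrite tnth_mktuple.
exact: measurable_coord_rV.
Qed.

Let ratI (q : rat * rat) : set R := [set` `]ratr q.1, ratr q.2[].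

Let ratI_nbhs (x : R) (P : set R) : nbhs x P ->
  exists q, ratI q x /\ ratI q `<=` P.
Proof.
move=> /nbhs_ballP[e /= e0 eP].
have xe : x - e < x by rewrite ltrBlDr ltrDl.
have xe' : x < x + e by rewrite ltrDl.
have [p] := rat_in_itvoo xe; have [q] := rat_in_itvoo xe'.
rewrite !in_itv/= => /andP[q1 q2] /andP[p1 p2].
exists (p, q); split; first by rewrite /ratI/= in_itv/= p2.
move=> y; rewrite /ratI/= in_itv/= => /andP[py yq]; apply: eP.
by rewrite ball_itv/= in_itv/= (lt_trans p1 py) (lt_trans yq q2).
Qed.

Let open_rat_box (A : set 'rV[R]_n) (x : 'rV[R]_n) : open A -> A x ->
  exists c : {ffun 'I_n -> rat * rat}, (forall i, ratI (c i) (x 0 i)) /\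
    [set y : 'rV[R]_n | forall i, ratI (c i) (y 0 i)] `<=` A.
Proof.
move=> oA Ax; have [P nP PA] : nbhs x A by exact: open_nbhs_nbhs.
have [c cP] := choice (fun i => ratI_nbhs (nP 0 i)).
exists [ffun i => c i]; split=> [i|y yc]; first by rewrite ffunE; exact: (cP i).1.
apply: PA => i j; rewrite !ord1; apply: (cP j).2.
by have := yc j; rewrite ffunE.
Qed.

Lemma measurable_rV_of_tuple : measurable_fun [set: _] rV_of_tuple.
Proof.
apply: (@measurability _ _ _ _ _ _ (@open 'rV[R]_n)) => //.
move=> _ [A oA <-]; rewrite setTI.
pose box (c : {ffun 'I_n -> rat * rat}) :=
  [set t : n.-tuple mR | forall i, ratI (c i) (tnth t i)].
pose D := [set c | box c `<=` rV_of_tuple @^-1` A].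
rewrite (_ : _ @^-1` _ = \bigcup_(c in D) box c).
  rewrite bigcup_mkcond; apply: countable_bigcupT_measurable => // c.
  case: ifP => // _.
  by apply: (@measurable_tuple_box R n (fun i => ratI (c i))) => i;
    exact: measurable_itv.
apply/seteqP; split => [t /= At|t [c Dc] /Dc//].
have [c [tc cA]] := open_rat_box oA At.
exists c => [u uc /=|i /=]; last by have := tc i; rewrite mxE.
by apply: cA => i; rewrite mxE; exact: uc.
Qed.

Definition lebesgue_rV : set 'rV[R]_n -> \bar R :=
  pushforward (@tuple_lebesgue R n) rV_of_tuple.

Let lebesgue_rV0 : lebesgue_rV set0 = 0%E.
Proof. by rewrite /lebesgue_rV /pushforward preimage_set0 measure0. Qed.

Let lebesgue_rV_ge0 A : (0 <= lebesgue_rV A)%E.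
Proof. exact: (measure_ge0 (tuple_lebesgue n)). Qed.

Let lebesgue_rV_sigma_additive : semi_sigma_additive lebesgue_rV.
Proof. exact: pushforward_semi_sigma_additive measurable_rV_of_tuple. Qed.

HB.instance Definition _ := isMeasure.Build _ _ _ lebesgue_rV
  lebesgue_rV0 lebesgue_rV_ge0 lebesgue_rV_sigma_additive.

Let lebesgue_rV_sigma_finite : sigma_finite [set: _] lebesgue_rV.
Proof.
exact: pushforward_sigma_finite (sigma_finiteT _) measurable_tuple_of_rV
  rV_of_tupleK.
Qed.

HB.instance Definition _ := Measure_isSigmaFinite.Build _ _ _ lebesgue_rV
  lebesgue_rV_sigma_finite.

Lemma lebesgue_rV_box (B : 'I_n -> set mR) : (forall i, measurable (B i)) ->
  lebesgue_rV [set x | forall i, B i (x 0 i)] =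
  (\prod_(i < n) lebesgue_measure (B i))%E.
Proof.
move=> mB; rewrite -tuple_lebesgue_box// /lebesgue_rV /pushforward.
congr (tuple_lebesgue n _).
by apply/seteqP; split => t /= tB i; have := tB i; rewrite mxE.
Qed.

End rV_lebesgue.

Section domains.
Context {R : realType}.

Definition enorm n (x : 'rV[R]_n) : R := Num.sqrt (\sum_(i < n) x 0 i ^+ 2).

(* [edist_set x set0 = 0] by the convention on [inf]. *)
Definition edist_set n (x : 'rV[R]_n) (A : set 'rV[R]_n) : R :=
  inf [set enorm (x - y) | y in A].

Definition boundary n (A : set 'rV[R]_n) : set 'rV[R]_n :=
  closure A `\` interior A.

Definition bounded_domain n (A : set 'rV[R]_n) : Prop :=
  [/\ A !=set0, open A, connected A & bounded_set A].

Definition C11 n (h : 'rV[R]_n -> R) : Prop :=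
  (forall x, differentiable h x) /\
  exists L : R, forall x y v,
    `|'d h x v - 'd h y v| <= L * enorm (x - y) * enorm v.

(* Near each boundary point [A] is, after an orthogonal change of coordinates
   [x |-> x *m Q], the region above the graph of a C^{1,1} function of the
   first n coordinates [col' ord_max]. *)
Definition C11_boundary n (A : set 'rV[R]_n.+1) : Prop :=
  forall z, boundary A z ->
  exists (Q : 'M[R]_n.+1) (h : 'rV[R]_n -> R) (r : R),
    [/\ Q *m Q^T = 1%:M, C11 h, 0 < r &
     forall x, enorm (x - z) < r ->
       A x <-> h (col' ord_max (x *m Q)) < (x *m Q) 0 ord_max].

End domains.

Section green.
Context {R : realType} (n : nat) (Omega : set 'rV[R]_n).
Implicit Types (G DG : 'rV[R]_n -> 'rV[R]_n -> R) (f u : 'rV[R]_n -> R).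

Let mu : {measure set 'rV[R]_n -> \bar R} := @lebesgue_rV R n.

Definition bdist (x : 'rV[R]_n) : R := edist_set x (boundary Omega).

Definition green_bound (s gamma : R) (x y : 'rV[R]_n) : R :=
  (enorm (x - y) `^ (n%:R - 2 * s))^-1 *
  Num.min (bdist x * bdist y / enorm (x - y) ^+ 2) 1 `^ gamma.

Definition green_kernel (s gamma : R) G : Prop :=
  [/\ measurable_fun (Omega `*` Omega) (fun p : 'rV[R]_n * 'rV[R]_n => G p.1 p.2),
      forall x y, Omega x -> Omega y -> G x y = G y x &
      exists2 C : R, 0 < C & forall x y, Omega x -> Omega y -> x != y ->
        C^-1 * green_bound s gamma x y <= G x y <= C * green_bound s gamma x y].

Definition green_operator G f (x : 'rV[R]_n) : R :=
  \int[mu]_(y in Omega) (G x y * f y).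

Definition kernel_normal_derivative (gamma : R) G DG : Prop :=
  measurable_fun (boundary Omega `*` Omega)
    (fun p : 'rV[R]_n * 'rV[R]_n => DG p.1 p.2) /\
  forall z, boundary Omega z ->
  forall x : nat -> 'rV[R]_n, (forall j, Omega (x j)) -> x @ \oo --> z ->
  {ae mu, forall y, Omega y ->
    G (x j) y / bdist (x j) `^ gamma @[j --> \oo] --> DG z y}.

Definition normal_quotient (gamma : R) u (x : 'rV[R]_n) : R :=
  u x / bdist x `^ gamma.

Definition has_normal_derivative (gamma : R) u (z : 'rV[R]_n) : Prop :=
  cvg (normal_quotient gamma u x @[x --> within Omega (nbhs z)]).

Definition normal_derivative (gamma : R) u (z : 'rV[R]_n) : R :=
  lim (normal_quotient gamma u x @[x --> within Omega (nbhs z)]).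

(* Essential support, as elements of L^1 are classes modulo a.e. equality. *)
Definition ess_support f : set 'rV[R]_n :=
  [set x | Omega x /\ forall U, nbhs x U ->
     ~ {ae mu, forall y, U y -> Omega y -> f y = 0}].

Definition L1c f : Prop :=
  mu.-integrable Omega (EFin \o f) /\ compact (ess_support f).

Definition L1norm f : R := \int[mu]_(y in Omega) `|f y|.

End green.

(* Main.v *)
(* Fix z on the boundary and put e = dist(z, supp f) > 0. For x near z the
   points y of supp f stay at distance at least e / (2n) from x, and there
   G(x, y) / delta(x)^gamma <= C delta(y)^gamma |x - y|^(2s - 2gamma - n), which
   is at most a constant times e^(2s - 2gamma - n) because delta is bounded.
   Hence G(x, .) f / delta(x)^gamma is dominated by a multiple of |f|, and
   dominated convergence along sequences gives the limit, its formula and the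
   estimate. *)

Require Import Defs.
From HB Require Import structures.
From mathcomp Require Import all_boot all_order all_algebra.
From mathcomp Require Import all_classical all_reals all_analysis.
From mathcomp Require Import measurable_realfun ring.

Set Implicit Arguments.
Unset Strict Implicit.
Unset Printing Implicit Defensive.

Import Order.TTheory GRing.Theory Num.Theory.
Import numFieldNormedType.Exports.

Local Open Scope classical_set_scope.
Local Open Scope ring_scope.

(** * Sup norm, Euclidean norm and distance to a set *)

Lemma le_coord_norm (R : realType) n (x : 'rV[R]_n) i : `|x 0 i| <= `|x|.
Proof. by rewrite [leRHS]mx_normrE; exact: (le_bigmax _ _ (0, i)). Qed.

Lemma norm_le_enorm (R : realType) n (x : 'rV[R]_n) : `|x| <= enorm x.
Proof.
rewrite [leLHS]mx_normrE; apply/bigmax_leP; split; first exact: sqrtr_ge0.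
move=> [i j] _ /=; rewrite ord1 -sqrtr_sqr ler_sqrt ?sqr_ge0//.
  by rewrite (bigD1 j)//= lerDl sumr_ge0// => k _; exact: sqr_ge0.
by rewrite sumr_ge0// => k _; exact: sqr_ge0.
Qed.

(** Each of the [n] squares is at most the square of the sup norm, and [n <= n ^ 2]; this crude
    constant avoids the square root of [n]. *)
Lemma enorm_le_norm (R : realType) n (x : 'rV[R]_n) : enorm x <= n%:R * `|x|.
Proof.
have n0 : 0 <= n%:R * `|x| by rewrite mulr_ge0.
rewrite -(ger0_norm n0) -sqrtr_sqr ler_sqrt ?sqr_ge0//.
apply: (@le_trans _ _ (\sum_(i < n) `|x| ^+ 2)).
  apply: ler_sum => i _.
  by rewrite -real_normK ?num_real// lerXn2r ?nnegrE//; exact: le_coord_norm.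
rewrite sumr_const card_ord -[leLHS]mulr_natl exprMn.
apply: ler_wpM2r; first exact: sqr_ge0.
rewrite -natrX ler_nat; case: n {x n0} => // n; exact: (@leq_pexp2l n.+1 1 2).
Qed.

Lemma edist_set_le (R : realType) n (x : 'rV[R]_n) (A : set 'rV[R]_n) y :
  A y -> edist_set x A <= enorm (x - y).
Proof.
move=> Ay; apply: ge_inf; last by exists y.
by exists 0 => _ [z _ <-]; exact: sqrtr_ge0.
Qed.

Lemma edist_set_ge0 (R : realType) n (x : 'rV[R]_n) (A : set 'rV[R]_n) :
  0 <= edist_set x A.
Proof.
have [->|/set0P[y Ay]] := eqVneq A set0.
  by rewrite /edist_set image_set0 inf0.
apply: lb_le_inf; first by exists (enorm (x - y)), y.
by move=> _ [z _ <-]; exact: sqrtr_ge0.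
Qed.

(** Some sup-norm ball around [x] misses the closed set [A], and the Euclidean norm dominates the
    sup norm, so its radius bounds the infimum from below. Nonemptiness excludes the default value 0
    of [inf]. *)
Lemma edist_set_gt0 (R : realType) n (x : 'rV[R]_n) (A : set 'rV[R]_n) :
  A !=set0 -> closed A -> ~ A x -> 0 < edist_set x A.
Proof.
move=> [y Ay] cA nAx.
have /nbhs_ballP[e /= e0 eA] : nbhs x (~` A).
  by apply: open_nbhs_nbhs; split => //; exact: closed_openC.
apply: (lt_le_trans e0); apply: lb_le_inf; first by exists (enorm (x - y)), y.
move=> _ [z Az <-]; rewrite leNgt; apply/negP => xz.
apply: (eA z) => //; rewrite -ball_normE /=.
exact: le_lt_trans (norm_le_enorm _) xz.
Qed.

(** * Almost-everywhere statements and the essential support *)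

(* Instance search does not find the a.e. filter of [lebesgue_rV], so [filterS]
   cannot be applied there directly. *)
Lemma ae_imply d (T : sigmaRingType d) (R : realType)
    (mu : {measure set T -> \bar R}) (P Q : T -> Prop) :
  (forall x, P x -> Q x) ->
  {ae mu, forall x, P x} -> {ae mu, forall x, Q x}.
Proof. exact: filterS. Qed.

Lemma ae_forall_countable d (T : sigmaRingType d) (R : realType)
    (mu : {measure set T -> \bar R}) (I : countType) (P : I -> T -> Prop) :
  (forall i, {ae mu, forall x, P i x}) -> {ae mu, forall x i, P i x}.
Proof.
move=> aeP.
have /ae_foralln : forall k : nat,
    {ae mu, forall x i, unpickle k = Some i -> P i x}.
  move=> k; case ki : (unpickle k) => [i|]; last exact: aeW.
  by apply: filterS (aeP i) => x Pix j [<-].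
by apply: filterS => x Px i; apply: (Px (pickle i)); exact: pickleK.
Qed.

(** Balls of the sup norm are cubes; rational centres and radii [1 / (k + 1)] make the family
    countable. *)
Definition rat_cube (R : realType) n (c : {ffun 'I_n -> rat} * nat) :
  set 'rV[R]_n := ball (\row_i ratr (c.1 i) : 'rV[R]_n) c.2.+1%:R^-1.

Lemma rat_cube_basis (R : realType) n (x : 'rV[R]_n) (U : set 'rV[R]_n) :
  nbhs x U -> exists c, rat_cube c x /\ rat_cube c `<=` U.
Proof.
move=> /nbhs_ballP[e /= e0 eU].
have e20 : 0 < e / 2 by rewrite divr_gt0.
have [k _ /(_ k (leqnn k)) /= ke] := near_infty_natSinv_lt (PosNum e20).
pose r : R := k.+1%:R^-1.
have r0 : 0 < r by rewrite invr_gt0.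
(* A rational centre within [r] of [x] puts [x] in the cube, and the cube then lies in the ball of
   radius [r + r < e] around [x]. *)
have /choice[q qP] : forall i, exists q : rat, `|ratr q - x 0 i| < r.
  move=> i; have : x 0 i - r < x 0 i + r.
    by rewrite ltrBlDr -addrA ltrDl addr_gt0.
  move=> /rat_in_itvoo[q]; rewrite in_itv/= => /andP[q1 q2].
  by exists q; rewrite ltr_distl q1.
exists (finfun q, k) => /=; split.
  by split=> // i j; rewrite !ord1 /ball/= mxE ffunE; exact: qP.
move=> y cy; apply: eU.
apply: (@le_ball _ _ _ (r + r)); first by rewrite [leRHS]splitr lerD// ltW.
apply: ball_triangle cy; apply: ball_sym.
by split=> // i j; rewrite !ord1 /ball/= mxE ffunE; exact: qP.
Qed.

(** A Lindelöf argument: a point of [Omega] off the support has a neighbourhood where [f] vanishes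
    a.e., which shrinks to a rational cube. There are only countably many cubes, so the exceptional
    null sets add up to a null set. *)
Lemma ae_eq0_ess_supportC (R : realType) n (Omega : set 'rV[R]_n)
    (f : 'rV[R]_n -> R) :
  {ae (@lebesgue_rV R n : {measure set 'rV[R]_n -> \bar R}),
    forall y, Omega y -> ~ ess_support Omega f y -> f y = 0}.
Proof.
set mu : {measure set _ -> \bar _} := @lebesgue_rV R n.
pose null (U : set 'rV[R]_n) := {ae mu, forall y, U y -> Omega y -> f y = 0}.
have /ae_forall_countable ae0 : forall c,
    {ae mu, forall y, null (rat_cube c) -> rat_cube c y -> Omega y -> f y = 0}.
  move=> c; have [cN|cN] := pselect (null (rat_cube c)); last exact: aeW.
  by apply: ae_imply cN => y fy _.
apply: ae_imply ae0 => y fy Oy.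
move=> /not_andP[//|/existsNP[U /not_implyP[yU /contrapT fU]]].
have [c [cy cU]] := rat_cube_basis yU.
by apply: (fy c) => //; apply: ae_imply fU => w fw /cU; exact: fw.
Qed.

(** * Limits along sequences *)

Lemma cvg_ball_natSinv (R : realType) (V : pseudoMetricType R) (z : V)
    (x_ : nat -> V) : (forall k, ball z k.+1%:R^-1 (x_ k)) -> x_ @ \oo --> z.
Proof.
move=> zx; apply/cvg_ballP => e e0.
have [N _ Ne] := near_infty_natSinv_lt (PosNum e0).
by exists N => // k /Ne /= /ltW ke; exact: le_ball (zx k).
Qed.

Lemma closure_seq (R : realType) (V : pseudoMetricType R) (A : set V) (z : V) :
  closure A z ->
  exists x_ : nat -> V, (forall j, A (x_ j)) /\ x_ @ \oo --> z.
Proof.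
move=> Az; have /choice[x_ x_P] : forall k : nat,
    exists x, A x /\ ball z k.+1%:R^-1 x.
  by move=> k; apply: Az; apply: nbhsx_ballx; rewrite invr_gt0.
exists x_; split=> [j|]; first exact: (x_P j).1.
by apply: cvg_ball_natSinv => k; exact: (x_P k).2.
Qed.

(** If the limit fails for a neighbourhood [W] of [l], each ball of radius [1 / (k + 1)] contains a
    point of [A] sent outside [W]; these points form a sequence contradicting the hypothesis. *)
Lemma cvg_within_seq (R : realType) (V : pseudoMetricType R)
    (U : topologicalType) (A : set V) (z : V) (u : V -> U) (l : U) :
  (forall x_ : nat -> V, (forall j, A (x_ j)) -> x_ @ \oo --> z ->
    u (x_ j) @[j --> \oo] --> l) ->
  u x @[x --> within A (nbhs z)] --> l.
Proof.
move=> ul W lW; apply: contrapT => nW.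
have /choice[x_ x_P] : forall k : nat,
    exists x, [/\ A x, ball z k.+1%:R^-1 x & ~ W (u x)].
  move=> k; apply: contrapT => nx; apply: nW.
  apply/nbhs_ballP; exists k.+1%:R^-1; first by rewrite /= invr_gt0.
  by move=> x zx Ax; apply: contrapT => nWx; apply: nx; exists x.
have Ax k : A (x_ k) by have [] := x_P k.
have x_z : x_ @ \oo --> z.
  by apply: cvg_ball_natSinv => k; have [] := x_P k.
have [N _ /(_ N (leqnn N))] := ul _ Ax x_z W lW.
by have [_ _ +] := x_P N.
Qed.

(** * Dominated convergence for a parameter tending to a point *)

Section dominated_within.
Context d (T : measurableType d) (R : realType).
Context (mu : {measure set T -> \bar R}) (D : set T) (mD : measurable D).

(** Dominated convergence for a constant sequence turns an a.e. bound into integrability. *)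
Lemma ae_dominated_integrable (f g : T -> R) : measurable_fun D f ->
  mu.-integrable D (EFin \o g) -> (forall y, D y -> 0 <= g y) ->
  {ae mu, forall y, D y -> `|f y| <= g y} ->
  mu.-integrable D (EFin \o f) /\
  `|\int[mu]_(y in D) f y| <= \int[mu]_(y in D) g y.
Proof.
move=> mf ig g0 fg.
have mg : measurable_fun D g by apply/measurable_EFinP; case/integrableP : ig.
have [||||if_ _ _] := @dominated_convergence _ _ _ mu _ mD
  (fun=> EFin \o f) (EFin \o f) (EFin \o g) _ _ _ ig.
- by move=> _; exact/measurable_EFinP.
- exact/measurable_EFinP.
- by apply: aeW => y _; exact: cvg_cst.
- by apply: filterS fg => y fg n Dy; rewrite /= lee_fin fg.
split=> //; apply: le_trans (le_normr_Rintegral mD if_) _.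
have iaf : mu.-integrable D (fun y => (`|f y|)%:E) := integrable_abse if_.
rewrite /Rintegral fine_le//; [exact: integrable_fin_num..|].
apply: ae_ge0_le_integral => //; last exact/measurable_EFinP.
by case/integrableP : iaf.
Qed.

(** The null set off which [F] converges may depend on the sequence, so the limit is taken along
    each sequence separately and reassembled by [cvg_within_seq]. *)
Lemma dominated_cvg_within (V : pseudoMetricType R) (A : set V) (z : V)
    (F : V -> T -> R) (f g : T -> R) : closure A z ->
  (forall x, A x -> measurable_fun D (F x)) -> measurable_fun D f ->
  mu.-integrable D (EFin \o g) ->
  (\forall x \near within A (nbhs z),
    {ae mu, forall y, D y -> `|F x y| <= g y}) ->
  (forall x_ : nat -> V, (forall j, A (x_ j)) -> x_ @ \oo --> z ->
    {ae mu, forall y, D y -> F (x_ j) y @[j --> \oo] --> f y}) ->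
  mu.-integrable D (EFin \o f) /\
  \int[mu]_(y in D) F x y @[x --> within A (nbhs z)] -->
    \int[mu]_(y in D) f y.
Proof.
move=> Az mF mf ig Fg Ff.
have seqP (x_ : nat -> V) : (forall j, A (x_ j)) -> x_ @ \oo --> z ->
    mu.-integrable D (EFin \o f) /\
    \int[mu]_(y in D) F (x_ j) y @[j --> \oo] --> \int[mu]_(y in D) f y.
  move=> Ax xz; have [N _ NFg] := xz _ Fg.
  (* Domination holds only near [z], that is from some index [N] on; the sequence shifted by [N] is
     dominated throughout. *)
  have [||||if_ _ cvF] := @dominated_convergence _ _ _ mu _ mD
    (fun j => EFin \o F (x_ (j + N)%N)) (EFin \o f) (EFin \o g) _ _ _ ig.
  - by move=> j; apply/measurable_EFinP; exact: mF.
  - exact/measurable_EFinP.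
  - apply: filterS (Ff x_ Ax xz) => y Fy Dy.
    apply: cvg_EFin; first exact: nearW.
    by rewrite (cvg_shiftn N (fun j => F (x_ j) y)); exact: Fy.
  - apply: ae_foralln => j.
    apply: filterS (NFg (j + N)%N (leq_addl _ _) (Ax _)) => y Fy Dy.
    by rewrite /= lee_fin Fy.
  split=> //; rewrite -(cvg_shiftn N).
  apply: fine_cvg; rewrite fineK//; exact: integrable_fin_num.
split; last by apply: cvg_within_seq => x_ Ax xz; have [] := seqP x_ Ax xz.
(* Integrability of [f] comes from any single sequence tending to [z]; one exists since [z] lies in
   the closure of [A]. *)
have [x_ [Ax xz]] := closure_seq Az.
by have [] := seqP x_ Ax xz.
Qed.
End dominated_within.

(** * The boundary and pointwise bounds on the kernel *)

Lemma boundary_closed (R : realType) n (A : set 'rV[R]_n) : closed (boundary A).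
Proof.
rewrite /boundary setDE; apply: closedI; first exact: closed_closure.
exact/open_closedC/open_interior.
Qed.

Lemma boundary_measurable (R : realType) n (A : set 'rV[R]_n) :
  measurable (boundary A).
Proof.
rewrite -[boundary A]setCK; apply: measurableC; apply: open_measurable_rV.
exact/closed_openC/boundary_closed.
Qed.

Lemma boundary_open_disjoint (R : realType) n (A : set 'rV[R]_n) x :
  open A -> A x -> ~ boundary A x.
Proof. by move=> /interior_id oA Ax [_]; rewrite oA. Qed.

Lemma bdist_bounded (R : realType) n (Omega : set 'rV[R]_n.+1) :
  bounded_set Omega -> boundary Omega !=set0 ->
  exists2 D : R, 0 < D & forall y, Omega y -> bdist Omega y <= D.
Proof.
move=> /pinfty_ex_gt0[M M0 OM] [z bz].
exists (n.+1%:R * (M + `|z|)).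
  by rewrite mulr_gt0// ltr_wpDr.
move=> y Oy; apply: le_trans (edist_set_le _ bz) _.
apply: le_trans (enorm_le_norm _) _; rewrite ler_wpM2l//.
by apply: le_trans (ler_normB _ _) _; rewrite lerD2r; exact: OM.
Qed.

Lemma green_bound_ge0 (R : realType) n (Omega : set 'rV[R]_n)
    (s gamma : R) x y :
  0 <= green_bound Omega s gamma x y.
Proof. by rewrite mulr_ge0 ?invr_ge0 ?powR_ge0. Qed.

(* Far from the diagonal the singular factor is bounded, and keeping
   [delta(x) delta(y) / |x - y|^2] in the minimum leaves exactly the factor
   [delta(x)^gamma] that the normal quotient divides out. *)
Lemma green_bound_le (R : realType) n (Omega : set 'rV[R]_n)
    (s gamma r : R) x y :
  0 <= gamma -> 2 * s <= n%:R -> 0 < r -> r <= enorm (x - y) ->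
  green_bound Omega s gamma x y <=
  bdist Omega x `^ gamma * bdist Omega y `^ gamma *
  r `^ (2 * s - 2 * gamma - n%:R).
Proof.
move=> g0 sn r0 rxy; rewrite /green_bound.
set e := enorm (x - y) in rxy *; set dx := bdist Omega x.
set dy := bdist Omega y.
have e0 : 0 < e := lt_le_trans r0 rxy.
have dx0 : 0 <= dx := edist_set_ge0 _ _.
have dy0 : 0 <= dy := edist_set_ge0 _ _.
have de0 : 0 <= dx * dy / e ^+ 2 by rewrite !mulr_ge0 ?invr_ge0 ?sqr_ge0.
have min_le : Num.min (dx * dy / e ^+ 2) 1 `^ gamma <=
    dx `^ gamma * dy `^ gamma * e `^ (- 2 * gamma).
  apply: (@le_trans _ _ ((dx * dy / e ^+ 2) `^ gamma)).
    by rewrite ge0_ler_powR ?nnegrE ?le_min ?de0 ?ler01 ?ge_min ?lexx.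
  rewrite !powRM ?invr_ge0 ?sqr_ge0 ?mulr_ge0//.
  by rewrite -powR_mulrn ?(ltW e0)// -powRN -powRrM.
apply: le_trans (ler_wpM2l _ min_le) _; first by rewrite invr_ge0 powR_ge0.
rewrite -powRN mulrCA -powRD; last by rewrite (gt_eqF e0) implybT.
rewrite ler_wpM2l ?mulr_ge0 ?powR_ge0//.
have -> : - (n%:R - 2 * s) + - 2 * gamma = 2 * s - 2 * gamma - n%:R by ring.
(* The exponent is nonpositive because [2 * s <= n] and [gamma >= 0], so the power decreases and [e]
   may be replaced by the smaller [r]. *)
rewrite -[_ - n%:R]opprK !(powRN _ (- _)) lef_pV2 ?posrE ?powR_gt0//.
rewrite ge0_ler_powR ?nnegrE ?(ltW r0) ?(ltW e0)//.
by rewrite oppr_ge0 subr_le0 (le_trans _ sn)// gerBl mulr_ge0.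
Qed.

Lemma green_quotient_le (R : realType) n (Omega : set 'rV[R]_n)
    (s gamma C r g : R) x y :
  0 <= gamma -> 2 * s <= n%:R -> 0 < C -> 0 < r -> r <= enorm (x - y) ->
  C^-1 * green_bound Omega s gamma x y <= g <=
    C * green_bound Omega s gamma x y ->
  `|g / bdist Omega x `^ gamma| <=
  C * bdist Omega y `^ gamma * r `^ (2 * s - 2 * gamma - n%:R).
Proof.
move=> gamma0 sn C0 r0 rxy /andP[gge gle].
have g0 : 0 <= g.
  by apply: le_trans gge; rewrite mulr_ge0 ?green_bound_ge0// invr_ge0 ltW.
rewrite ger0_norm ?mulr_ge0 ?invr_ge0 ?powR_ge0//.
(* Division by zero yields 0, so the bound is trivial if the denominator vanishes. *)
have [d0|d0] := eqVneq (bdist Omega x `^ gamma) 0.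
  by rewrite d0 invr0 mulr0 !mulr_ge0 ?powR_ge0 ?(ltW C0).
rewrite ler_pdivrMr ?lt_neqAle ?powR_ge0 1?eq_sym ?d0//.
apply: le_trans gle _.
apply: le_trans (ler_wpM2l (ltW C0) (green_bound_le Omega gamma0 sn r0 rxy)) _.
by rewrite -[X in _ * (X * _)]mulrC -!mulrA (mulrC (bdist Omega x `^ _)).
Qed.

(** * Separation of the support from the boundary, and the empty support *)

Lemma ess_support_dist (R : realType) n (Omega : set 'rV[R]_n)
    (f : 'rV[R]_n -> R) (z : 'rV[R]_n) :
  open Omega -> L1c Omega f -> boundary Omega z ->
  ess_support Omega f !=set0 -> 0 < edist_set z (ess_support Omega f).
Proof.
move=> oO [_ cK] bz K0; apply: edist_set_gt0 => //.
  by apply: compact_closed => //; exact: norm_hausdorff.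
by move=> [Oz _]; exact: boundary_open_disjoint bz.
Qed.

(** With empty support [f] vanishes a.e. on [Omega], so the zero function dominates [|f|]. *)
Lemma integrable_L1norm_eq0 (R : realType) n (Omega : set 'rV[R]_n)
    (f : 'rV[R]_n -> R) : measurable Omega ->
  (@lebesgue_rV R n).-integrable Omega (EFin \o f) ->
  ess_support Omega f = set0 -> L1norm Omega f = 0.
Proof.
move=> mO fi K0.
set mu : {measure set _ -> \bar _} := @lebesgue_rV R n.
have mf : measurable_fun Omega f.
  by apply/measurable_EFinP; case/integrableP : fi.
have [||||_ +] := @ae_dominated_integrable _ _ R mu _ mO
    (fun y => `|f y|) (cst 0).
- exact: measurableT_comp.
- exact: integrable0.
- by [].
- apply: ae_imply (ae_eq0_ess_supportC Omega f) => y fy Oy.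
  by rewrite /= fy ?normr0// K0.
- by rewrite /Rintegral integral0 normr_le0 => /eqP.
Qed.

(** * The normal derivative of a Green potential *)

(** The support enters through a lower bound [e] on its distance to [z] rather than through
    [edist_set], which is 0 for an empty support; any positive [e] then covers that case. [C] is
    fixed before [f], [z] and [e]. *)
Lemma green_normal_derivative (R : realType) n (Omega : set 'rV[R]_n.+1)
    (s gamma : R) (G DG : 'rV[R]_n.+1 -> 'rV[R]_n.+1 -> R) :
  open Omega -> bounded_set Omega -> 0 < gamma -> 2 * s <= n.+1%:R ->
  green_kernel Omega s gamma G -> kernel_normal_derivative Omega gamma G DG ->
  exists2 C : R, 0 < C &
  forall (f : 'rV[R]_n.+1 -> R) (z : 'rV[R]_n.+1) (e : R),
  (@lebesgue_rV R n.+1).-integrable Omega (EFin \o f) -> boundary Omega z ->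
  0 < e -> (forall y, ess_support Omega f y -> e <= enorm (z - y)) ->
  [/\ \forall x \near within Omega (nbhs z),
        (@lebesgue_rV R n.+1).-integrable Omega (fun y => (G x y * f y)%:E),
      has_normal_derivative Omega gamma (green_operator Omega G f) z,
      (@lebesgue_rV R n.+1).-integrable Omega (fun y => (DG z y * f y)%:E),
      normal_derivative Omega gamma (green_operator Omega G f) z =
        \int[@lebesgue_rV R n.+1]_(y in Omega) (DG z y * f y) &
      `|normal_derivative Omega gamma (green_operator Omega G f) z| <=
        C * L1norm Omega f * e `^ (2 * s - 2 * gamma - n.+1%:R)].
Proof.
move=> oO bO g0 sn [mG _ [C C0 GC]] [mDG DGlim].
have mO : measurable Omega := open_measurable_rV oO.
have [b0|/set0P nb] := eqVneq (boundary Omega) set0.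
  by exists 1 => // f z e _; rewrite b0.
have [D D0 OD] := bdist_bounded bO nb.
set p := 2 * s - 2 * gamma - n.+1%:R.
(* With [N = n + 1], Euclidean distance at least [e] from [z] to [y] means sup distance at least
   [e / N = 2 * k * e]. Moving [z] to [x] by less than [k * e] leaves at least [k * e]. *)
pose k : R := (2 * n.+1%:R)^-1.
have k0 : 0 < k by rewrite invr_gt0 mulr_gt0.
pose C1 := C * D `^ gamma * k `^ p.
exists C1; first by rewrite !mulr_gt0 ?powR_gt0.
move=> f z e fi bz e0 supp_e.
pose mu : {measure set 'rV[R]_n.+1 -> \bar R} := @lebesgue_rV R n.+1.
pose F x y := G x y / bdist Omega x `^ gamma * f y.
pose g y := C1 * e `^ p * `|f y|.
have mf : measurable_fun Omega f.
  by apply/measurable_EFinP; case/integrableP : fi.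
have mG1 x : Omega x -> measurable_fun Omega (G x).
  move=> Ox; apply: (@measurable_comp _ _ _ _ _ _ _ _ _ (pair x) _ _ mG).
    exact: measurableX.
    by move=> _ [y Oy <-].
  exact: measurable_funTS (pair1_measurable x).
have mDG1 : measurable_fun Omega (DG z).
  apply: (@measurable_comp _ _ _ _ _ _ _ _ _ (pair z) _ _ mDG).
    by apply: measurableX mO; exact: boundary_measurable.
    by move=> _ [y Oy <-].
  exact: measurable_funTS (pair1_measurable z).
have gi : mu.-integrable Omega (EFin \o g).
  exact: (integrableZl mO (C1 * e `^ p) (integrable_abse fi)).
have nF : \forall x \near within Omega (nbhs z),
    Omega x /\ {ae mu, forall y, Omega y -> `|F x y| <= g y}.
  apply: filterS (nbhsx_ballx z (k * e) (mulr_gt0 k0 e0)) => x zx Ox.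
  split=> //; apply: ae_imply (ae_eq0_ess_supportC Omega f) => y fy Oy.
  (* Off the support [f y = 0] and both sides vanish; the kernel estimate is needed only on the
     support. *)
  have [/(fy Oy) fy0|/contrapT Ky] := pselect (~ ess_support Omega f y).
    by rewrite /F /g fy0 mulr0 !normr0 mulr0.
  have kxy : k * e <= `|x - y|.
    have : e <= n.+1%:R * `|z - y|.
      by apply: le_trans (supp_e _ Ky) _; exact: enorm_le_norm.
    rewrite mulrC -ler_pdivrMr// => ezy.
    have kee : k * e + k * e = e / n.+1%:R.
      have : n.+1%:R != 0 :> R by rewrite pnatr_eq0.
      by rewrite /k; move: (n.+1%:R : R) => N N0; field.
    have zxn : `|z - x| < k * e by move: zx; rewrite -ball_normE.
    have zyx : `|z - y| <= `|z - x| + `|x - y|.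
      have -> : z - y = (z - x) + (x - y) by rewrite addrA subrK.
      exact: ler_normD.
    rewrite -(lerD2l (k * e)) kee (le_trans ezy)// (le_trans zyx)//.
    by rewrite lerD2r ltW.
  have kxy' := le_trans kxy (norm_le_enorm (x - y)).
  have xy : x != y.
    by rewrite -subr_eq0 -normr_gt0 (lt_le_trans _ kxy)// mulr_gt0.
  rewrite /F /g normrM ler_wpM2r//.
  have := green_quotient_le (ltW g0) sn C0 (mulr_gt0 k0 e0) kxy'
    (GC x y Ox Oy xy).
  move=> /le_trans; apply; rewrite -/p powRM ?(ltW k0) ?(ltW e0)// mulrA.
  rewrite !ler_wpM2r ?powR_ge0// ler_wpM2l ?(ltW C0)//.
  rewrite ge0_ler_powR ?nnegrE ?edist_set_ge0 ?(ltW g0) ?(ltW D0)//.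
  exact: OD.
have mF x : Omega x -> measurable_fun Omega (F x).
  by move=> Ox; do 2?apply: measurable_funM => //; exact: mG1.
have g_ge0 y : Omega y -> 0 <= g y.
  by rewrite /g /C1 !mulr_ge0 ?powR_ge0 ?(ltW C0).
have FI x : Omega x -> {ae mu, forall y, Omega y -> `|F x y| <= g y} ->
    mu.-integrable Omega (EFin \o F x) /\
    `|\int[mu]_(y in Omega) F x y| <= \int[mu]_(y in Omega) g y.
  by move=> Ox; exact: ae_dominated_integrable (mF x Ox) gi g_ge0.
have GF x : Omega x -> mu.-integrable Omega (EFin \o F x) ->
    mu.-integrable Omega (fun y => (G x y * f y)%:E).
  move=> Ox Fi.
  (* [x] lies in the open set [Omega], hence off the closed boundary; a nonzero factor allows
     multiplying back from [F x] to [G x y * f y]. *)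
  have d0 : bdist Omega x `^ gamma != 0.
    rewrite gt_eqF// powR_gt0// edist_set_gt0//; first exact: boundary_closed.
    exact: boundary_open_disjoint.
  have := integrableZl mO (bdist Omega x `^ gamma) Fi.
  congr (_.-integrable _ _); apply/funext => y /=.
  by rewrite -EFinM /F mulrA mulrCA divff// mulr1.
have qF : \forall x \near within Omega (nbhs z),
    normal_quotient Omega gamma (green_operator Omega G f) x =
    \int[mu]_(y in Omega) F x y.
  apply: filterS nF => x [Ox /(FI _ Ox)[Fi _]].
  rewrite /normal_quotient /green_operator -RintegralZr//; last exact: GF.
  by apply: eq_Rintegral => y _; rewrite /F mulrAC.
have Oz : closure Omega z by case: bz.
have PF : ProperFilter (within Omega (nbhs z)) := within_nbhs_proper Oz.
have [] := @dominated_cvg_within _ _ R mu _ mO _ Omega z F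
    (fun y => DG z y * f y) g Oz mF _ gi.
- exact: measurable_funM.
- by apply: filterS nF => x [].
- move=> x_ Ox xz; apply: ae_imply (DGlim z bz x_ Ox xz) => y Gy Oy.
  by apply: cvgMr_tmp; exact: Gy.
move=> DGi cvF.
have cvq : normal_quotient Omega gamma (green_operator Omega G f) x
    @[x --> within Omega (nbhs z)] --> \int[mu]_(y in Omega) (DG z y * f y).
  by apply: cvg_trans cvF; apply: near_eq_cvg; apply: filterS qF => x ->.
have ndE : normal_derivative Omega gamma (green_operator Omega G f) z =
    \int[mu]_(y in Omega) (DG z y * f y).
  exact: cvg_lim cvq.
split=> //.
- by apply: filterS nF => x [Ox /(FI _ Ox)[Fi _]]; exact: GF.
- by apply/cvg_ex; eexists; exact: cvq.
rewrite ndE.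
(* For [x] near [z] the integral of [F x] is bounded by that of [g], a bound free of [x] that
   survives the limit. *)
have cvn : `|\int[mu]_(y in Omega) F x y| @[x --> within Omega (nbhs z)] -->
    `|\int[mu]_(y in Omega) (DG z y * f y)| by exact: cvg_norm.
rewrite -(cvg_lim (@norm_hausdorff _ _) cvn).
apply: limr_le; first by apply/cvg_ex; eexists; exact: cvn.
apply: filterS nF => x [Ox /(FI _ Ox)[_]] /le_trans; apply.
rewrite /g RintegralZl//; last exact: (integrable_abse fi).
by rewrite mulrAC.
Qed.

Theorem theorem3p15 (R : realType) (n : nat) (Omega : set 'rV[R]_n.+1)
    (s gamma : R) (G DG : 'rV[R]_n.+1 -> 'rV[R]_n.+1 -> R)
    (hOmega : bounded_domain Omega) (hbd : C11_boundary Omega)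
    (hs : 0 < s <= 1) (hgamma : 0 < gamma <= 1) (hsn : 2 * s <= n.+1%:R)
    (hG : green_kernel Omega s gamma G)
    (hDG : kernel_normal_derivative Omega gamma G DG) :
  (forall f, L1c Omega f -> forall z, boundary Omega z ->
    [/\ \forall x \near within Omega (nbhs z),
          (@lebesgue_rV R n.+1).-integrable Omega
            (fun y => (G x y * f y)%:E),
        has_normal_derivative Omega gamma (green_operator Omega G f) z,
        (@lebesgue_rV R n.+1).-integrable Omega (fun y => (DG z y * f y)%:E) &
        normal_derivative Omega gamma (green_operator Omega G f) z =
          \int[@lebesgue_rV R n.+1]_(y in Omega) (DG z y * f y)]) /\
  (exists2 C : R, 0 < C &
    forall f, L1c Omega f -> forall z, boundary Omega z ->
      `|normal_derivative Omega gamma (green_operator Omega G f) z| <=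
      C * L1norm Omega f *
      edist_set z (ess_support Omega f) `^ (2 * s - 2 * gamma - n.+1%:R)).
Proof.
have [_ oO _ bO] := hOmega; have /andP[g0 _] := hgamma.
have [C C0 CP] := green_normal_derivative oO bO g0 hsn hG hDG.
have supp_e f z : L1c Omega f -> boundary Omega z ->
    ess_support Omega f !=set0 ->
    0 < edist_set z (ess_support Omega f) /\ forall y, ess_support Omega f y ->
      edist_set z (ess_support Omega f) <= enorm (z - y).
  by move=> fL bz K0; split; [exact: ess_support_dist|exact: edist_set_le].
split=> [f fL z bz|].
  (* For an empty support the separation condition is vacuous and [e = 1] serves. *)
  have [K0|/set0P K0] := eqVneq (ess_support Omega f) set0.
    by have [] := CP f z 1 fL.1 bz ltr01 ltac:(by rewrite K0).
  by have [e0 ef] := supp_e f z fL bz K0; have [] := CP f z _ fL.1 bz e0 ef.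
exists C => // f fL z bz.
have [K0|/set0P K0] := eqVneq (ess_support Omega f) set0; last first.
  by have [e0 ef] := supp_e f z fL bz K0; have [] := CP f z _ fL.1 bz e0 ef.
(* Here the distance is the default 0, but the L^1 norm vanishes: the bound with [e = 1] forces the
   derivative to be 0, and the right-hand side is 0 too. *)
have [_ _ _ _] := CP f z 1 fL.1 bz ltr01 ltac:(by rewrite K0).
have f0 := integrable_L1norm_eq0 (open_measurable_rV oO) fL.1 K0.
by rewrite f0 mulr0 !mul0r.
Qed.
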